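(* Let $\kappa\in\mathscr K$, and let $r_n$ ($n\in\mathbb N$) be its iterated kernels and $r=\sum_{n\ge1}r_n$ its resolvent. Let $f,g:\mathbb R_+\to\mathbb R_+$ be two measurable functions such that for any $T>0$ and some $n\in\mathbb N$ $$t\mapsto\int_0^t r_n(t,s)f(s)\,ds\in L^\infty(0,T),$$ and for almost all $t\in(0,\infty)$ $$\int_0^t r(t,s)g(s)\,ds<+\infty .$$ If for almost all $t\in(0,\infty)$ $$f(t)\le g(t)+\int_0^t\kappa(t,s)f(s)\,ds,$$ then for almost all $t\in(0,\infty)$ $$f(t)\le g(t)+\int_0^t r(t,s)g(s)\,ds .$$
   Context: Let $\triangle:=\{(t,s)\in\mathbb R_+^2: s\le t\}$. $\mathscr K$ denotes the set of all measurable functions $\kappa:\triangle\to\mathbb R_+$ such that for every $T>0$ $$t\mapsto\int_0^t\kappa(t,s)\,ds\in L^\infty(0,T)\quad\text{and}\quad \limsup_{\varepsilon\downarrow0}\Big\|\int_{\cdot}^{\cdot+\varepsilon}\kappa(\cdot+\varepsilon,s)\,ds\Big\|_{L^\infty(0,T)}<1 .$$ For $\kappa\in\mathscr K$ the iterated kernels are $r_1(t,s):=\kappa(t,s)$, $r_{n+1}(t,s):=\int_s^t\kappa(t,u)r_n(u,s)\,du$, $n\in\mathbb N$. The resolvent is $r(t,s):=\sum_{n=1}^\infty r_n(t,s)$, a series which is known to converge for almost all $(t,s)\in\triangle$. *)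

(* Defs.v *)
From HB Require Import structures.
From mathcomp Require Import all_boot all_order all_algebra.
From mathcomp Require Import all_classical all_reals all_analysis.
From mathcomp Require Import measurable_realfun ess_sup_inf.

Set Implicit Arguments.
Unset Strict Implicit.
Unset Printing Implicit Defensive.

Import Order.TTheory GRing.Theory Num.Theory.
Import numFieldNormedType.Exports.

Local Open Scope classical_set_scope.
Local Open Scope ring_scope.
Local Open Scope ereal_scope.

(* Measurability is Borel measurability.  Kernels are functions of a pair
   (t, s), and only their values on the triangle are ever used. *)
Definition triangle (R : realType) : set (R * R) :=
  [set p | (0 <= p.2)%R /\ (p.2 <= p.1)%R].

Definition Linfty_norm (R : realType) (T : R) (h : R -> \bar R) : \bar R :=
  'N[mrestr lebesgue_measure (measurable_itv `]0%R, T[)]_+oo[h].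

(* Integrals such as t |-> \int_0^t k(t, s) ds may be infinite at some points,
   hence membership in L^oo(0, T) is stated for extended-real functions. *)
Definition in_Linfty (R : realType) (T : R) (h : R -> \bar R) : Prop :=
  measurable_fun `]0%R, T[ h /\ Linfty_norm T h < +oo.

Definition kernel_class (R : realType) (k : R * R -> R) : Prop :=
  [/\ measurable_fun (@triangle R) k,
      forall p, triangle p -> (0 <= k p)%R
    & forall T : R, (0 < T)%R ->
        in_Linfty T
          (fun t => \int[lebesgue_measure]_(s in `[0%R, t]) (k (t, s))%:E) /\
        limf_esup
          (fun e : R => Linfty_norm T (fun t =>
             \int[lebesgue_measure]_(s in `[t, (t + e)%R]) (k ((t + e)%R, s))%:E))
          (0%R : R)^'+ < 1].

(* The iterated kernels are indexed by n >= 1: [iterated_kernel k 1] is k.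
   From n = 2 on they may take the value +oo (on a null set). *)
Definition iterated_kernel (R : realType) (k : R * R -> R) (n : nat) :
    R * R -> \bar R :=
  iter n.-1
    (fun (q : R * R -> \bar R) (p : R * R) =>
       \int[lebesgue_measure]_(u in `[p.2, p.1])
         ((k (p.1, u))%:E * q (u, p.2)))
    (EFin \o k).

Definition resolvent (R : realType) (k : R * R -> R) (p : R * R) : \bar R :=
  \sum_(1 <= n <oo) iterated_kernel k n p.

(* Main.v *)
Require Import Defs.
From HB Require Import structures.
From mathcomp Require Import all_boot all_order all_algebra.
From mathcomp Require Import all_classical all_reals all_analysis.
From mathcomp Require Import measurable_realfun ess_sup_inf.
From mathcomp Require Import ring lra.

(** Write K for the integral operator phi |-> \int_0^t k(t, s) phi(s) ds.
    By Tonelli's theorem its powers K^n are the integral operators of the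
    iterated kernels, and summing over n >= 1 gives the integral operator of
    the resolvent ([kernel_op_iter], [kernel_op_series]).

    As K is monotone, the hypothesis f <= g + K f iterates to
    f <= g + K g + ... + K^(m-1) g + K^m f ([volterra_iterated_inequality]),
    and everything reduces to K^m f -> 0 almost everywhere on each bounded
    interval (0, T).  Some power K^n f is bounded on (0, T), so it is enough
    that K be a strict contraction there.  This holds in a weighted uniform
    norm: [kernel_class_contraction] gives beta < 1 and an exponential weight
    w(t) = exp(lambda t) >= 1 with K w <= beta w almost everywhere on (0, T),
    whence K^(n+m) f <= C beta^m w ([volterra_iter_contraction]).

    The contraction estimate is where the definition of the kernel class
    enters.  Its limsup condition bounds the integral of k(t, .) over the
    window [t - delta, t] by some alpha < 1 ([kernel_class_window]); to the
    left of the window the weight is smaller than w(t) by the factor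
    exp(- lambda delta), so that a large lambda makes the contribution of that
    part, controlled by the uniform bound on the full integral, as small as
    desired ([integral_expR_weight]).

    All functions and kernels are extended by zero to the whole line and plane,
    so that one works throughout with everywhere defined measurable nonnegative
    functions, possibly with value +oo; every inequality is between such
    functions and no subtraction occurs. *)

Import Order.TTheory GRing.Theory Num.Theory.
Import numFieldNormedType.Exports.
Local Open Scope classical_set_scope.
Local Open Scope ring_scope.
Local Open Scope ereal_scope.

Set Implicit Arguments.
Unset Strict Implicit.
Unset Printing Implicit Defensive.

(** * Almost everywhere properties on the real line *)

Section LebesgueAE.
Context (R : realType).
Local Notation mu := (@lebesgue_measure R).

Let ae_filter :=
  ae_filter_ringOfSetsType (mu : {measure set _ -> \bar R}).

(** Almost everywhere properties form a filter; restated for predicates on the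
    carrier of the reals, because instance resolution does not identify it with
    the type alias over which Lebesgue measure is defined. *)
Lemma lebesgue_aeS (P Q : R -> Prop) : (forall x, P x -> Q x) ->
  {ae mu, forall x : R, P x} -> {ae mu, forall x : R, Q x}.
Proof. by move=> PQ aeP; refine (@filterS _ _ ae_filter _ _ _ aeP). Qed.

Lemma lebesgue_aeS2 (P Q S : R -> Prop) : (forall x, P x -> Q x -> S x) ->
  {ae mu, forall x : R, P x} -> {ae mu, forall x : R, Q x} ->
  {ae mu, forall x : R, S x}.
Proof.
by move=> PQS aeP aeQ; refine (@filterS2 _ _ ae_filter _ _ _ _ aeP aeQ).
Qed.

Lemma lebesgue_ae_foralln (P : nat -> R -> Prop) :
  (forall n, {ae mu, forall x : R, P n x}) ->
  {ae mu, forall x : R, forall n, P n x}.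
Proof. exact: (ae_foralln (mu := mu : {measure set _ -> \bar R})). Qed.

Lemma lebesgue_ae_all_rat (P : rat -> R -> Prop) :
  (forall q, {ae mu, forall t : R, P q t}) ->
  {ae mu, forall t : R, forall q, P q t}.
Proof.
move=> aeP; have := lebesgue_ae_foralln
  (fun n => aeP (odflt 0%R (unpickle n : option rat))).
by apply: lebesgue_aeS => t Pt q; have := Pt (pickle q); rewrite pickleK.
Qed.

(** The two sides agree on half-open intervals, and these determine the
    measure. *)
Lemma lebesgue_measure_translate (e : R) (A : set R) : measurable A ->
  mu ((fun x => (x - e)%R) @^-1` A) = mu A.
Proof.
move=> mA.
have m_shift : measurable_fun [set: measurableTypeR R]
    ((fun x => (x - e)%R) : measurableTypeR R -> measurableTypeR R).
  exact: measurable_funB.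
rewrite [RHS](@lebesgue_measure_unique _ (pushforward mu
  ((fun x => (x - e)%R) : measurableTypeR R -> measurableTypeR R)))//.
move=> _ [[a b] _ <-]; rewrite /=.
transitivity (mu ((fun x => (x - e)%R) @^-1` `]a, b])); last by [].
rewrite (_ : _ @^-1` _ = `](a + e)%R, (b + e)%R]%classic); last first.
  by apply/seteqP; split=> x /=; rewrite !in_itv/= ltrBrDr lerBlDr.
rewrite !lebesgue_measure_itv/= !lte_fin ltrD2r.
by case: ifP => // _; rewrite -!EFinB opprD addrACA subrr addr0.
Qed.

Lemma lebesgue_ae_translate (e : R) (P : R -> Prop) :
  {ae mu, forall x : R, P x} -> {ae mu, forall x : R, P (x - e)%R}.
Proof.
move=> [N [mN N0 PN]]; exists ((fun x => (x - e)%R) @^-1` N); split.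
- rewrite -[X in measurable X]setTI.
  have mshift : measurable_fun setT (fun x : R => x - e)%R.
    exact: measurable_funB.
  exact: mshift.
- by rewrite -[RHS]N0; exact: lebesgue_measure_translate.
- by move=> x nP; exact: (PN (x - e)%R).
Qed.

End LebesgueAE.

(** * Composition and iteration of nonnegative integral operators *)

Section KernelOperators.
Context d (T : measurableType d) (R : realType).
Variable mu : {sigma_finite_measure set T -> \bar R}.
Implicit Types (q : T * T -> \bar R) (phi : T -> \bar R).

Definition kernel_op q phi (t : T) : \bar R := \int[mu]_s (q (t, s) * phi s).

Definition kernel_comp q q' (p : T * T) : \bar R :=
  \int[mu]_u (q (p.1, u) * q' (u, p.2)).

Lemma kernel_op_ge0 q phi : (forall p, 0 <= q p) -> (forall s, 0 <= phi s) ->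
  forall t, 0 <= kernel_op q phi t.
Proof. by move=> q0 f0 t; apply: integral_ge0 => s _; exact: mule_ge0. Qed.

Lemma kernel_comp_ge0 q q' : (forall p, 0 <= q p) -> (forall p, 0 <= q' p) ->
  forall p, 0 <= kernel_comp q q' p.
Proof. by move=> q0 f0 t; apply: integral_ge0 => s _; exact: mule_ge0. Qed.

Lemma measurable_row q t : measurable_fun setT q ->
  measurable_fun setT (fun s => q (t, s)).
Proof. by move=> mq; apply: (measurableT_comp mq); exact: measurable_pair1. Qed.

Lemma measurable_kernel_op q phi :
  (forall p, 0 <= q p) -> (forall s, 0 <= phi s) ->
  measurable_fun setT q -> measurable_fun setT phi ->
  measurable_fun setT (kernel_op q phi).
Proof.
move=> q0 f0 mq mf.
apply: (measurable_fun_fubini_tonelli_F (fun p => q p * phi p.2)).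
  apply: emeasurable_funM => //.
  by apply: (measurableT_comp mf); exact: measurable_snd.
by move=> p; exact: mule_ge0.
Qed.

Lemma measurable_kernel_comp q q' :
  (forall p, 0 <= q p) -> (forall p, 0 <= q' p) ->
  measurable_fun setT q -> measurable_fun setT q' ->
  measurable_fun setT (kernel_comp q q').
Proof.
move=> q0 q'0 mq mq'.
apply: (@measurable_fun_fubini_tonelli_F _ _ _ _ _ _
   (fun z : (T * T) * T => q (z.1.1, z.2) * q' (z.2, z.1.2))).
  apply: emeasurable_funM.
    apply: (measurableT_comp mq).
    apply: (@measurable_fun_pair _ _ _ _ _ _ (fst \o fst) snd).
      exact: (measurableT_comp measurable_fst measurable_fst).
    exact: measurable_snd.
  apply: (measurableT_comp mq').
  apply: (@measurable_fun_pair _ _ _ _ _ _ snd (snd \o fst)).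
    exact: measurable_snd.
  exact: (measurableT_comp measurable_snd measurable_fst).
by move=> p; exact: mule_ge0.
Qed.

(** Tonelli's theorem for (u, s) |-> q (t, u) * q' (u, s) * phi s. *)
Lemma kernel_op_comp q q' phi :
  (forall p, 0 <= q p) -> (forall p, 0 <= q' p) -> (forall s, 0 <= phi s) ->
  measurable_fun setT q -> measurable_fun setT q' -> measurable_fun setT phi ->
  kernel_op (kernel_comp q q') phi = kernel_op q (kernel_op q' phi).
Proof.
move=> q0 q'0 f0 mq mq' mf; apply/funext => t; rewrite /kernel_op /kernel_comp.
have -> : \int[mu]_s (\int[mu]_u (q (t, u) * q' (u, s)) * phi s) =
    \int[mu]_s \int[mu]_u (q (t, u) * q' (u, s) * phi s).
  apply: eq_integral => s _; rewrite ge0_integralZr//.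
    apply: emeasurable_funM; first exact: measurable_row.
    by apply: (measurableT_comp mq'); exact: measurable_pair2.
  by move=> u _; exact: mule_ge0.
rewrite -(fubini_tonelli (fun p => q (t, p.1) * q' p * phi p.2)); first last.
- by move=> p; rewrite !mule_ge0.
- apply: emeasurable_funM; last first.
    by apply: (measurableT_comp mf); exact: measurable_snd.
  apply: emeasurable_funM => //.
  by apply: (measurableT_comp (measurable_row t mq)); exact: measurable_fst.
apply: eq_integral => u _ /=; rewrite -ge0_integralZl//.
- by apply: eq_integral => s _; rewrite muleA.
- by apply: emeasurable_funM => //; exact: measurable_row.
- by move=> s _; exact: mule_ge0.
Qed.

Lemma kernel_opD q phi psi :
  (forall p, 0 <= q p) -> (forall s, 0 <= phi s) -> (forall s, 0 <= psi s) ->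
  measurable_fun setT q -> measurable_fun setT phi ->
  measurable_fun setT psi ->
  kernel_op q (phi \+ psi) = kernel_op q phi \+ kernel_op q psi.
Proof.
move=> q0 f0 g0 mq mf mg; apply/funext => t /=; rewrite /kernel_op.
rewrite -ge0_integralD//.
- by apply: eq_integral => s _; rewrite ge0_muleDr.
- by move=> s _; exact: mule_ge0.
- by apply: emeasurable_funM => //; exact: measurable_row.
- by move=> s _; exact: mule_ge0.
- by apply: emeasurable_funM => //; exact: measurable_row.
Qed.

Lemma kernel_opZ q (c : R) phi :
  (forall p, 0 <= q p) -> (0 <= c)%R -> (forall s, 0 <= phi s) ->
  measurable_fun setT q -> measurable_fun setT phi ->
  kernel_op q (fun s => c%:E * phi s) = fun t => c%:E * kernel_op q phi t.
Proof.
move=> q0 c0 f0 mq mf; apply/funext => t; rewrite /kernel_op -ge0_integralZl//.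
- by apply: eq_integral => s _; rewrite muleCA.
- by apply: emeasurable_funM => //; exact: measurable_row.
- by move=> s _; exact: mule_ge0.
Qed.

(** Monotone convergence.  Finiteness of [phi] lets it be pulled out of the
    series. *)
Lemma kernel_op_series (q : nat -> T * T -> \bar R) (phi : T -> R) t :
  (forall n p, 0 <= q n p) -> (forall s, (0 <= phi s)%R) ->
  (forall n, measurable_fun setT (q n)) -> measurable_fun setT phi ->
  kernel_op (fun p => \sum_(0 <= n <oo) q n p) (EFin \o phi) t =
  \sum_(0 <= n <oo) kernel_op (q n) (EFin \o phi) t.
Proof.
move=> q0 f0 mq mf; rewrite /kernel_op -integral_nneseries//=.
- apply: eq_integral => s _; rewrite muleC -nneseriesZl//.
  by apply: eq_eseriesr => n _; rewrite muleC.
- move=> n; apply: emeasurable_funM; first exact: measurable_row.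
  exact/measurable_EFinP.
- by move=> n s _; apply: mule_ge0 => //; rewrite lee_fin.
Qed.

(** The index is shifted: [kernel_iter q n] is the iterated kernel number
    n + 1. *)
Definition kernel_iter q n : T * T -> \bar R := iter n (kernel_comp q) q.

Lemma kernel_iter_ge0 q n : (forall p, 0 <= q p) ->
  forall p, 0 <= kernel_iter q n p.
Proof. by move=> q0; elim: n => //= n ih; exact: kernel_comp_ge0. Qed.

Lemma measurable_kernel_iter q n : (forall p, 0 <= q p) ->
  measurable_fun setT q -> measurable_fun setT (kernel_iter q n).
Proof.
move=> q0 mq; elim: n => //= n ih; apply: measurable_kernel_comp => //.
exact: kernel_iter_ge0.
Qed.

Lemma iter_kernel_op_ge0 q phi n : (forall p, 0 <= q p) ->
  (forall s, 0 <= phi s) -> forall t, 0 <= iter n (kernel_op q) phi t.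
Proof. by move=> q0 f0; elim: n => //= n ih; exact: kernel_op_ge0. Qed.

Lemma measurable_iter_kernel_op q phi n : (forall p, 0 <= q p) ->
  (forall s, 0 <= phi s) -> measurable_fun setT q -> measurable_fun setT phi ->
  measurable_fun setT (iter n (kernel_op q) phi).
Proof.
move=> q0 f0 mq mf; elim: n => //= n ih; apply: measurable_kernel_op => //.
exact: iter_kernel_op_ge0.
Qed.

Lemma kernel_op_iter q phi n : (forall p, 0 <= q p) ->
  (forall s, 0 <= phi s) -> measurable_fun setT q -> measurable_fun setT phi ->
  kernel_op (kernel_iter q n) phi = iter n.+1 (kernel_op q) phi.
Proof.
move=> q0 f0 mq mf; elim: n => //= n ih; rewrite kernel_op_comp ?ih//.
  exact: kernel_iter_ge0.
exact: measurable_kernel_iter.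
Qed.

End KernelOperators.

(** * Gronwall's inequality for Volterra operators *)

Section VolterraGronwall.
Context (R : realType).
Local Notation mu := (@lebesgue_measure R).
Variable q : R * R -> \bar R.
Hypothesis q_ge0 : forall p, 0 <= q p.
Hypothesis q_meas : measurable_fun setT q.
Hypothesis q_volterra : forall p, ~ triangle p -> q p = 0.
Local Notation K := (kernel_op mu q).
Implicit Types phi psi w : R -> \bar R.

(** The kernel only looks at times in [0, t], so an inequality that holds
    almost everywhere on (0, T) is turned into one that holds at every t < T;
    exceptional null sets do not accumulate under iteration. *)
Lemma volterra_op_le phi psi (T : R) :
  (forall s, 0 <= phi s) -> (forall s, 0 <= psi s) ->
  measurable_fun setT phi -> measurable_fun setT psi ->
  {ae mu, forall s : R, (0 < s < T)%R -> phi s <= psi s} ->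
  forall t, (t < T)%R -> K phi t <= K psi t.
Proof.
move=> phi0 psi0 mphi mpsi le_ae t tT.
(* the bound on phi says nothing about s = 0, which belongs to [0, t] *)
have s_neq0 : {ae mu, forall s : R, s <> 0%R}.
  exists [set 0%R]; split => //; first exact: lebesgue_measure_set1.
  by move=> s /= /contrapT.
have qle : {ae mu, forall s : R, setT s -> q (t, s) * phi s <= q (t, s) * psi s}.
  apply: lebesgue_aeS2 le_ae s_neq0 => s le_s /eqP s0 _.
  have [[/= s_ge0 s_le]|nts] := pselect (triangle (t, s)).
    by rewrite lee_wpmul2l// le_s// lt_neqAle eq_sym s0 s_ge0 (le_lt_trans s_le).
  by rewrite q_volterra// !mul0e.
apply: ae_ge0_le_integral qle => //.
- by move=> s _; exact: mule_ge0.
- by apply: emeasurable_funM => //; exact: measurable_row.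
- by move=> s _; exact: mule_ge0.
- by apply: emeasurable_funM => //; exact: measurable_row.
Qed.

(** Induction on [m]: insert the bound for [f] into [K f] and expand by
    additivity. *)
Lemma volterra_iterated_inequality f g m :
  (forall s, 0 <= f s) -> (forall s, 0 <= g s) ->
  measurable_fun setT f -> measurable_fun setT g ->
  {ae mu, forall t : R, (0 < t)%R -> f t <= g t + K f t} ->
  {ae mu, forall t : R, (0 < t)%R ->
    f t <= \sum_(0 <= j < m) iter j K g t + iter m K f t}.
Proof.
move=> f0 g0 mf mg f_le.
have Kg0 j : forall s, 0 <= iter j K g s by apply: iter_kernel_op_ge0.
have Kf0 j : forall s, 0 <= iter j K f s by apply: iter_kernel_op_ge0.
have mKg j : measurable_fun setT (iter j K g).
  by apply: measurable_iter_kernel_op.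
have mKf j : measurable_fun setT (iter j K f).
  by apply: measurable_iter_kernel_op.
elim: m => [|m ih].
  by apply: lebesgue_aeS f_le => t _ _; rewrite big_geq// add0e.
apply: lebesgue_aeS f_le => t f_le_t t0; apply: (le_trans (f_le_t t0)).
pose S s := \sum_(0 <= j < m) iter j K g s.
have S0 s : 0 <= S s by apply: sume_ge0.
have mS : measurable_fun setT S by apply: emeasurable_sum.
have KS : K S t = \sum_(0 <= j < m) iter j.+1 K g t.
  rewrite -ge0_integral_sum//=.
  - by apply: eq_integral => s _; rewrite ge0_sume_distrr.
  - move=> j; apply: emeasurable_funM; last exact: mKg.
    exact: measurable_row.
  - by move=> j s _; apply: mule_ge0 => //; exact: Kg0.
have -> : \sum_(0 <= j < m.+1) iter j K g t + iter m.+1 K f t =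
    g t + K (S \+ iter m K f) t.
  by rewrite kernel_opD//= KS big_nat_recl//= -[LHS]addeA.
rewrite leeD2l//; apply: (@volterra_op_le _ _ (t + 1)) => //.
- by move=> s; rewrite adde_ge0.
- by apply: emeasurable_funD; [exact: mS|exact: mKf].
- by apply: lebesgue_aeS ih => s ih_s /andP[s0 _]; exact: ih_s.
- by rewrite ltrDl.
Qed.

(** One application of [K] to C * beta ^+ m * w gains a factor beta, by
    homogeneity and monotonicity. *)
Lemma volterra_iter_contraction w phi (T beta C : R) m :
  (0 <= beta)%R -> (0 <= C)%R ->
  (forall s, 0 <= w s) -> measurable_fun setT w ->
  (forall s, 0 <= phi s) -> measurable_fun setT phi ->
  {ae mu, forall t : R, (0 < t < T)%R -> K w t <= beta%:E * w t} ->
  {ae mu, forall t : R, (0 < t < T)%R -> phi t <= C%:E * w t} ->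
  {ae mu, forall t : R, (0 < t < T)%R ->
    iter m K phi t <= (C * beta ^+ m)%:E * w t}.
Proof.
move=> beta0 C0 w0 mw phi0 mphi Kw phiw; elim: m => [|m ih].
  by apply: lebesgue_aeS phiw => t; rewrite expr0 mulr1.
apply: lebesgue_aeS Kw => t Kw_t tT; have Cm0 : (0 <= C * beta ^+ m)%R.
  by rewrite mulr_ge0// exprn_ge0.
rewrite exprSr mulrA EFinM -muleA.
apply: le_trans (lee_wpmul2l _ (Kw_t tT)); last by rewrite lee_fin.
rewrite iterS -(congr1 (@^~ t) (kernel_opZ mu q_ge0 Cm0 w0 q_meas mw)).
move: tT => /andP[_ tT]; apply: (volterra_op_le _ _ _ _ ih tT) => //.
- exact: (iter_kernel_op_ge0 mu m q_ge0 phi0).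
- by move=> s; rewrite mule_ge0// lee_fin.
- exact: (measurable_iter_kernel_op mu m q_ge0 phi0 q_meas mphi).
- exact: emeasurable_funM.
Qed.

(** The remainder K^(m+n) f of the iterated inequality is at most
    C * beta ^+ m * w, and this tends to 0 at every point of (0, T).  The
    intervals (0, N) with N a natural number exhaust the half-line. *)
Lemma volterra_gronwall f g :
  (forall s, 0 <= f s) -> (forall s, 0 <= g s) ->
  measurable_fun setT f -> measurable_fun setT g ->
  (forall T : R, (0 < T)%R -> exists w : R -> R, exists beta : R,
    [/\ (0 <= beta < 1)%R, measurable_fun setT w,
        forall t, (0 <= w t)%R, forall t, (0 < t)%R -> (1 <= w t)%R
      & {ae mu, forall t : R, (0 < t < T)%R ->
          K (EFin \o w) t <= beta%:E * (w t)%:E}]) ->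
  (forall T : R, (0 < T)%R -> exists n, exists2 C : R, (0 <= C)%R &
    {ae mu, forall t : R, (0 < t < T)%R -> iter n K f t <= C%:E}) ->
  {ae mu, forall t : R, (0 < t)%R -> f t <= g t + K f t} ->
  {ae mu, forall t : R, (0 < t)%R ->
    f t <= g t + \sum_(0 <= n <oo) iter n.+1 K g t}.
Proof.
move=> f0 g0 mf mg contr bnd f_le.
suff onT T : {ae mu, forall t : R, (0 < t < T.+1%:R)%R ->
    f t <= g t + \sum_(0 <= n <oo) iter n.+1 K g t}.
  apply: lebesgue_aeS (lebesgue_ae_foralln onT) => t le_t t0.
  apply: (le_t (Num.truncn t)); rewrite t0/=.
  exact: truncnS_gt.
have T0 : (0 < T.+1%:R :> R)%R by rewrite ltr0n.
have [w [beta [/andP[beta0 beta1] mw w0 w1 Kw]]] := contr _ T0.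
have [n [C C0 fC]] := bnd _ T0.
have decay : {ae mu, forall t : R, forall m, (0 < t < T.+1%:R)%R ->
    iter (m + n) K f t <= (C * beta ^+ m)%:E * (w t)%:E}.
  apply: lebesgue_ae_foralln => m.
  have fCw : {ae mu, forall t : R, (0 < t < T.+1%:R)%R ->
      iter n K f t <= C%:E * (EFin \o w) t}.
    apply: lebesgue_aeS fC => t fC_t tT; apply: (le_trans (fC_t tT)).
    by rewrite -EFinM lee_fin ler_peMr// w1//; case/andP: tT.
  have w_ge0 t : 0 <= (EFin \o w) t by rewrite lee_fin.
  have w_meas : measurable_fun setT (EFin \o w) by exact/measurable_EFinP.
  have := volterra_iter_contraction m beta0 C0 w_ge0 w_meas
    (iter_kernel_op_ge0 mu n q_ge0 f0)
    (measurable_iter_kernel_op mu n q_ge0 f0 q_meas mf) Kw fCw.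
  by apply: lebesgue_aeS => t; rewrite iterD.
have step := lebesgue_ae_foralln (fun m =>
  volterra_iterated_inequality m f0 g0 mf mg f_le).
apply: lebesgue_aeS2 decay step => t decay_t step_t tT.
have t0 : (0 < t)%R by case/andP: tT.
apply/lee_addgt0Pr => e e0.
(* m is so large that the remainder of order m + n is at most e *)
have [m Cm] : exists m, (C * beta ^+ m * w t <= e)%R.
  have : (fun m => geometric (C * w t)%R beta m) @ \oo --> 0%R.
    by apply: cvg_geometric; rewrite ger0_norm.
  move=> /cvgrPdist_le/(_ _ e0)[m _ /(_ m)] /= /(_ (leqnn m)).
  rewrite sub0r normrN ger0_norm; last first.
    by rewrite !mulr_ge0// exprn_ge0.
  by exists m; rewrite mulrAC.
apply: (le_trans (step_t _ t0)); apply: leeD; last first.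
  by apply: le_trans (decay_t m tT) _; rewrite -EFinM lee_fin.
have iter0 j : 0 <= iter j K g t by exact: iter_kernel_op_ge0.
move: (m + n)%N => [|N].
  rewrite big_geq//; apply: adde_ge0 => //; apply: nneseries_ge0 => j _ _.
  exact: (iter0 j.+1).
rewrite big_nat_recl//= leeD2l//.
by apply: (nneseries_lim_ge N) => j _ _; exact: (iter0 j.+1).
Qed.

End VolterraGronwall.

(** * Essential bounds on bounded intervals *)

Section LinftyNorm.
Context (R : realType).
Local Notation mu := (@lebesgue_measure R).
Implicit Types (T : R) (h : R -> \bar R).

(** On an interval of positive length the sup norm is an essential supremum,
    which is attained as an almost everywhere bound. *)
Lemma Linfty_norm_ae T h (y : \bar R) : (0 < T)%R -> Linfty_norm T h <= y ->
  {ae mu, forall t : R, (0 < t < T)%R -> h t <= y}.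
Proof.
move=> T0; rewrite /Linfty_norm unlock /=.
have -> : 0 < mrestr mu (measurable_itv `]0%R, T[) setT.
  by rewrite /mrestr setTI lebesgue_measure_itv/= lte_fin T0 sube0 lte_fin.
move=> /ess_supP[N [mN N0 hN]]; exists (N `&` `]0%R, T[); split => //.
  exact: measurableI.
move=> t /= /not_implyP[tT nh]; split => //; apply: hN => /= le_h.
by apply: nh; apply: le_trans le_h; exact: lee_abs.
Qed.

Lemma in_Linfty_ae T h : (0 < T)%R -> in_Linfty T h ->
  exists2 C : R, (0 <= C)%R & {ae mu, forall t : R, (0 < t < T)%R -> h t <= C%:E}.
Proof.
move=> T0 [_ h_lty].
have h_fin : Linfty_norm T h \is a fin_num by rewrite ge0_fin_numE ?Lnorm_ge0.
exists (fine (Linfty_norm T h)); first by rewrite fine_ge0// Lnorm_ge0.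
by apply: Linfty_norm_ae => //; rewrite fineK.
Qed.

End LinftyNorm.

(** * Extension by zero and the resolvent *)

Section ZeroExtension.
Context (R : realType).
Local Notation mu := (@lebesgue_measure R).
Implicit Types (k : R * R -> R) (f phi h : R -> R).

Lemma measurable_triangle : measurable (@triangle R).
Proof.
have -> : @triangle R =
    ([set p | (0 <= p.2)%R] `&` [set p | (p.2 <= p.1)%R]) by [].
apply: measurableI.
  rewrite -[X in measurable X]setTI.
  rewrite [X in _ `&` X](_ : _ = (fun p : R * R => (0 <= p.2)%R) @^-1` [set true])//.
  exact: measurable_fun_ler.
rewrite -[X in measurable X]setTI.
rewrite [X in _ `&` X](_ : _ = (fun p : R * R => (p.2 <= p.1)%R) @^-1` [set true])//.
exact: measurable_fun_ler.
Qed.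

Definition zero_ext_kernel k (p : R * R) : \bar R := ((k \_ (@triangle R)) p)%:E.

Definition zero_ext f : R -> R := f \_ `[0%R, +oo[.

Lemma zero_ext_kernelE k p : triangle p -> zero_ext_kernel k p = (k p)%:E.
Proof. by move=> tp; rewrite /zero_ext_kernel patchE mem_set. Qed.

Lemma zero_ext_kernel_volterra k p : ~ triangle p -> zero_ext_kernel k p = 0.
Proof. by move=> tp; rewrite /zero_ext_kernel patchE memNset. Qed.

Lemma zero_extE f t : (0 <= t)%R -> zero_ext f t = f t.
Proof. by move=> t0; rewrite /zero_ext patchE mem_set//= in_itv/= t0. Qed.

Lemma zero_ext_ge0 f : (forall t, (0 <= t)%R -> (0 <= f t)%R) ->
  forall t, (0 <= zero_ext f t)%R.
Proof.
move=> f0 t; rewrite /zero_ext patchE; case: ifPn => //.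
by rewrite inE/= in_itv/= andbT; exact: f0.
Qed.

Lemma measurable_zero_ext f : measurable_fun (`[0%R, +oo[ : set R) f ->
  measurable_fun setT (zero_ext f).
Proof. by move=> mf; exact/(measurable_restrictT _ (measurable_itv _)). Qed.

Lemma zero_ext_kernel_ge0 k : (forall p, triangle p -> (0 <= k p)%R) ->
  forall p, 0 <= zero_ext_kernel k p.
Proof.
move=> k0 p; have [tp|tp] := pselect (triangle p).
  by rewrite zero_ext_kernelE// lee_fin k0.
by rewrite zero_ext_kernel_volterra.
Qed.

Lemma measurable_zero_ext_kernel k : measurable_fun (@triangle R) k ->
  measurable_fun setT (zero_ext_kernel k).
Proof.
move=> mk; apply/measurable_EFinP.
by apply/(measurable_restrictT _ measurable_triangle).
Qed.

(** The kernel itself cuts the integral over the line down to [0, t], because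
    it vanishes off the triangle. *)
Lemma volterra_opE (q : R * R -> \bar R) (phi h : R -> \bar R) t :
  (forall p, ~ triangle p -> q p = 0) ->
  (forall s, (0 <= s <= t)%R -> h s = q (t, s) * phi s) ->
  \int[mu]_(s in `[0%R, t]) h s = kernel_op mu q phi t.
Proof.
move=> qV hE; rewrite integral_mkcond; apply: eq_integral => s _.
rewrite patchE; case: ifPn; rewrite ?inE ?notin_setE/= in_itv/=.
  exact: hE.
by move=> nst; rewrite qV ?mul0e// => -[/= s0 st]; apply: nst; rewrite s0.
Qed.

Lemma kernel_iter_volterra (q : R * R -> \bar R) n :
  (forall p, ~ triangle p -> q p = 0) ->
  forall p, ~ triangle p -> kernel_iter mu q n p = 0.
Proof.
move=> qV; elim: n => [|n ih] p np; first exact: qV.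
rewrite /kernel_iter iterS /kernel_comp integral0_eq// => u _.
have [[/= u0 ut]|npu] := pselect (triangle (p.1, u)); last first.
  by rewrite qV// mul0e.
rewrite [X in _ * X]ih ?mule0// => -[/= s0 su]; apply: np; split => //.
exact: le_trans ut.
Qed.

(** For s <= t, the integrand over the whole line defining the iterated kernel
    at (t, s) vanishes unless s <= u <= t. *)
Lemma iterated_kernelE k n p : triangle p ->
  iterated_kernel k n.+1 p = kernel_iter mu (zero_ext_kernel k) n p.
Proof.
elim: n p => [|n ih] p tp; first by rewrite /= zero_ext_kernelE.
rewrite [LHS]integral_mkcond; apply: eq_integral => u _.
rewrite patchE; case: ifPn; rewrite ?inE ?notin_setE/= in_itv/=.
  case: tp => s0 st /andP[su ut].
  rewrite zero_ext_kernelE; last by split=> //=; exact: le_trans su.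
  by congr (_ * _); exact: ih.
move=> nu; have [[/= u0 ut]|npu] := pselect (triangle (p.1, u)); last first.
  by rewrite zero_ext_kernel_volterra// mul0e.
rewrite [X in _ = _ * X](_ : _ = 0) ?mule0//.
apply: (kernel_iter_volterra n (zero_ext_kernel_volterra k)).
by move=> [/= _ su]; apply: nu; rewrite su.
Qed.

Lemma resolventE k p : (forall p, triangle p -> (0 <= k p)%R) -> triangle p ->
  resolvent k p =
  \sum_(0 <= n <oo) kernel_iter mu (zero_ext_kernel k) n p.
Proof.
move=> k0 tp; rewrite /resolvent.
(* the series in resolvent starts at 1, the one in kernel_iter at 0 *)
rewrite -[LHS](nneseries_addn (f := fun n => iterated_kernel k n p) 1%N).
  by apply: eq_eseriesr => n _; rewrite addn1 iterated_kernelE.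
move=> [|n]; first by rewrite lee_fin k0.
rewrite iterated_kernelE//.
exact: (kernel_iter_ge0 mu n (zero_ext_kernel_ge0 k0) p).
Qed.

End ZeroExtension.

(** * The weighted contraction estimate *)

Section Contraction.
Context (R : realType).
Local Notation mu := (@lebesgue_measure R).

(** Monotone convergence along [1/(n+1), t], together with the fact that the
    point 0 has measure zero. *)
Lemma integral_closed_left_le (h : R -> \bar R) (t : R) (y : \bar R) :
  measurable_fun setT h -> (forall s, 0 <= h s) ->
  (forall a : R, (0 < a)%R -> \int[mu]_(s in `[a, t]) h s <= y) ->
  \int[mu]_(s in `[0%R, t]) h s <= y.
Proof.
move=> mh h0 le_y.
rewrite -integral_itv_obnd_cbnd; last exact: measurable_funTS.
rewrite itv_open_bnd_bigcup.
pose F n := [set` Interval (BLeft (0 + n.+1%:R^-1)%R) (BRight t)].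
have cvgF : \int[mu]_(s in F n) h s @[n --> \oo] -->
    \int[mu]_(s in \bigcup_n F n) h s.
  apply: ge0_nondecreasing_set_cvg_integral => //.
  - move=> n m nm; apply/subsetPset; apply: subset_itvr; rewrite bnd_simp/=.
    by rewrite lerD2l lef_pV2 ?posrE// ler_nat ltnS.
  - by move=> n; exact: measurable_itv.
  - by move=> n; exact: measurable_funTS.
rewrite -(cvg_lim _ cvgF)//; apply: lime_le.
  by apply/cvg_ex; eexists; exact: cvgF.
by apply: nearW => n; apply: le_y; rewrite add0r invr_gt0.
Qed.

(** A limsup smaller than 1 means that the supremum over some
    right-neighbourhood of 0 is smaller than 1; that supremum is alpha. *)
Lemma kernel_class_small_window (k : R * R -> R) (T : R) :
  kernel_class k -> (0 < T)%R ->
  exists alpha eps : R, [/\ (0 <= alpha < 1)%R, (0 < eps)%R &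
    forall e : R, (0 < e < eps)%R -> {ae mu, forall t : R, (0 < t < T)%R ->
      \int[mu]_(s in `[t, (t + e)%R]) (k ((t + e)%R, s))%:E <= alpha%:E}].
Proof.
move=> [_ _ /(_ T)] + T0 => /(_ T0)[_].
set F := (X in limf_esup X _).
move=> /ereal_inf_lt[_ [V V0 <-] supV1].
have [eps /= eps0 epsV] := V0.
have F0 e : 0 <= F e by exact: Lnorm_ge0.
have inV e : (0 < e < eps)%R -> V e.
  move=> /andP[e0 e_eps]; apply: epsV => //=.
  by rewrite sub0r normrN gtr0_norm.
have FV e : (0 < e < eps)%R -> F e <= ereal_sup (F @` V).
  by move=> /inV Ve; apply: ereal_sup_ubound; exists e.
have sup0 : 0 <= ereal_sup (F @` V).
  apply: (le_trans (F0 (eps / 2)%R)); apply: FV.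
  by rewrite divr_gt0//= gtr_pMr// invf_lt1// ltr1n.
have sup_fin : ereal_sup (F @` V) \is a fin_num.
  by rewrite ge0_fin_numE// (lt_trans supV1)// ltry.
exists (fine (ereal_sup (F @` V))), eps; split => //.
  by rewrite fine_ge0//= -lte_fin fineK.
move=> e /FV; rewrite -{1}(fineK sup_fin) => /(Linfty_norm_ae T0).
by apply: lebesgue_aeS.
Qed.

(** The bound of [kernel_class_small_window] concerns windows [t, t + e] with
    t > 0; translating it by e yields windows [t - e, t], but only for t > e.
    For t <= delta the whole of [0, t] must be controlled, and it is exhausted
    by the windows [t - e, t] with e < t increasing to t.  Letting e depend on t
    requires an exceptional null set independent of e, which is why e is taken
    rational. *)
Lemma kernel_class_window (k : R * R -> R) (T : R) :
  kernel_class k -> (0 < T)%R ->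
  exists alpha delta : R, [/\ (0 <= alpha < 1)%R, (0 < delta)%R &
    {ae mu, forall t : R, (0 < t < T)%R ->
      \int[mu]_(s in `[(t - delta)%R, t]) zero_ext_kernel k (t, s)
        <= alpha%:E}].
Proof.
move=> kC T0; have [mk k0 _] := kC.
have [alpha [eps [alpha01 eps0 win]]] := kernel_class_small_window kC T0.
have kap0 := zero_ext_kernel_ge0 k0.
have mkap t := measurable_row t (measurable_zero_ext_kernel mk).
pose small (q : rat) (t : R) :=
  (0 < t < T)%R -> (0 < (ratr q : R) < eps)%R -> (ratr q < t)%R ->
  \int[mu]_(s in `[(t - ratr q)%R, t]) zero_ext_kernel k (t, s) <= alpha%:E.
have win_rat : {ae mu, forall t : R, forall q, small q t}.
  apply: lebesgue_ae_all_rat => q; rewrite /small; set e : R := ratr q.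
  have [e_eps|e_eps] := boolP (0 < e < eps)%R; last exact: aeW.
  apply: lebesgue_aeS (lebesgue_ae_translate e (win e e_eps)).
  move=> t le_t /andP[t0 tT] _ et; case/andP: e_eps => e0 _.
  have : (0 < t - e < T)%R.
    by rewrite subr_gt0 et/= (le_lt_trans _ tT)// lerBlDr lerDl ltW.
  move=> /le_t; rewrite subrK; apply: le_trans.
  (* on this window k and its zero extension agree, as e < t *)
  rewrite le_eqVlt; apply/orP; left; apply/eqP; apply: eq_integral => s.
  rewrite inE/= in_itv/= => /andP[es st]; rewrite zero_ext_kernelE//.
  by split => //=; rewrite (le_trans _ es)// subr_ge0 ltW.
have [q] := rat_in_itvoo eps0; rewrite in_itv/= => q_eps.
exists alpha, (ratr q); split => //; first by case/andP: q_eps.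
apply: lebesgue_aeS win_rat => t win_t tT.
have [qt|tq] := ltP (ratr q) t; first exact: win_t.
(* from here on t <= delta, and the kernel vanishes to the left of 0 *)
apply: (@le_trans _ _ (\int[mu]_(s in `[0%R, t]) zero_ext_kernel k (t, s))).
  rewrite integral_mkcond [leRHS]integral_mkcond.
  apply: ge0_le_integral => //.
  - by move=> s _; exact: erestrict_ge0.
  - by apply/(measurable_restrictT _ (measurable_itv _)); exact: measurable_funTS.
  - by apply/(measurable_restrictT _ (measurable_itv _)); exact: measurable_funTS.
  move=> s _; have [[/= s0 st]|ns] := pselect (triangle (t, s)).
    rewrite !patchE !mem_set//= in_itv/= ?s0 ?st//.
    by rewrite andbT (le_trans _ s0)// subr_le0.
  by rewrite !patchE zero_ext_kernel_volterra//; do 2!case: ifP.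
apply: integral_closed_left_le => // a a0.
(* e > t - a makes [t - e, t] contain [a, t]; e > 0 and e < t keep e in the
   range of win_t *)
have [e] : exists e : rat, ratr e \in `]Num.max 0 (t - a), t[%R.
  by apply: rat_in_itvoo; case/andP: tT => t0 _; rewrite gt_max t0 gtrBl.
rewrite in_itv/= gt_max => /andP[/andP[e0 ae] et].
have e_eps : (0 < (ratr e : R) < eps)%R.
  by rewrite e0/= (lt_trans et)// (le_lt_trans tq)//; case/andP: q_eps.
apply: le_trans (win_t e tT e_eps et).
apply: ge0_subset_integral => //.
  by apply: measurable_funTS; exact: mkap.
apply: subset_itvr; rewrite bnd_simp.
by rewrite lerBlDr -lerBlDl ltW.
Qed.

(** The weight is increasing: it is at most its value at t on the window
    [t - delta, t], and at most its value at t - delta to the left of it.  The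
    second bound, applied to the whole integral, costs the factor
    expR (- (lambda * delta)). *)
Lemma integral_expR_weight (h : R -> \bar R) (t delta lambda alpha M : R) :
  measurable_fun setT h -> (forall s, 0 <= h s) ->
  (forall s, ~ (s <= t)%R -> h s = 0) -> (0 <= lambda)%R ->
  \int[mu]_s h s <= M%:E ->
  \int[mu]_(s in `[(t - delta)%R, t]) h s <= alpha%:E ->
  \int[mu]_s (h s * (expR (lambda * s))%:E) <=
  ((alpha + M * expR (- (lambda * delta))) * expR (lambda * t))%:E.
Proof.
move=> mh h0 ht lambda0 hM halpha.
pose A := (`[(t - delta)%R, t]%classic : set R).
have mhA : measurable_fun setT (h \_ A).
  by apply/(measurable_restrictT _ (measurable_itv _)); exact: measurable_funTS.
have hA0 s : 0 <= (h \_ A) s by exact: erestrict_ge0.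
have le_exp s r : (s <= r)%R -> (expR (lambda * s) <= expR (lambda * r))%R.
  by move=> sr; rewrite ler_expR ler_wpM2l.
apply: (@le_trans _ _ (\int[mu]_s ((expR (lambda * t))%:E * (h \_ A) s +
    (expR (lambda * (t - delta)))%:E * h s))).
  apply: ge0_le_integral => //.
  - by move=> s _; rewrite mule_ge0// lee_fin expR_ge0.
  - apply: emeasurable_funM => //; apply/measurable_EFinP.
    apply: measurableT_comp => //; exact: measurable_funM.
  - by apply: emeasurable_funD; apply: emeasurable_funM.
  move=> s _; have [st|ts] := leP s t; last first.
    rewrite [h s]ht; last by rewrite leNgt ts.
    by rewrite mul0e mule0 adde0 mule_ge0// lee_fin expR_ge0.
  have [sd|sd] := leP (t - delta)%R s.
    rewrite patchE mem_set; last by rewrite /A/= in_itv/= sd.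
    rewrite [leLHS]muleC; apply: (@le_trans _ _ ((expR (lambda * t))%:E * h s)).
      by rewrite lee_wpmul2r// lee_fin le_exp.
    by rewrite leeDl// mule_ge0// lee_fin expR_ge0.
  rewrite patchE memNset; last by rewrite /A/= in_itv/= leNgt sd.
  by rewrite mule0 add0e muleC lee_wpmul2r// lee_fin le_exp// ltW.
rewrite ge0_integralD//; first last.
- by apply: emeasurable_funM.
- by move=> s _; rewrite mule_ge0// lee_fin expR_ge0.
- by apply: emeasurable_funM.
- by move=> s _; rewrite mule_ge0// lee_fin expR_ge0.
rewrite !ge0_integralZl// ?lee_fin ?expR_ge0// -integral_mkcond.
rewrite mulrDl EFinD; apply: leeD.
  by rewrite [(alpha * _)%R]mulrC EFinM lee_wpmul2l// lee_fin expR_ge0.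
have -> : (M * expR (- (lambda * delta)) * expR (lambda * t) =
    expR (lambda * (t - delta)) * M)%R.
  by rewrite -mulrA -expRD [RHS]mulrC; congr (_ * expR _)%R; ring.
by rewrite EFinM lee_wpmul2l// lee_fin expR_ge0.
Qed.

(** Choose beta halfway between alpha and 1, and lambda so large that the part
    of the integral outside the window contributes at most beta - alpha. *)
Lemma kernel_class_contraction (k : R * R -> R) (T : R) :
  kernel_class k -> (0 < T)%R ->
  exists w : R -> R, exists beta : R,
    [/\ (0 <= beta < 1)%R, measurable_fun setT w,
        forall t, (0 <= w t)%R, forall t, (0 < t)%R -> (1 <= w t)%R
      & {ae mu, forall t : R, (0 < t < T)%R ->
          kernel_op mu (zero_ext_kernel k) (EFin \o w) t
            <= beta%:E * (w t)%:E}].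
Proof.
move=> kC T0; have [mk k0 /(_ T T0)[kLinfty _]] := kC.
have [M M0 kM] := in_Linfty_ae T0 kLinfty.
have [alpha [delta [/andP[alpha0 alpha1] delta0 kalpha]]] :=
  kernel_class_window kC T0.
have a1 : (0 < 1 - alpha)%R by rewrite subr_gt0.
(* by 1 + x <= expR x, this value forces
   M * expR (- (lambda * delta)) <= (1 - alpha) / 2 *)
pose lambda := (2 * M / (1 - alpha) / delta)%R.
have lambda0 : (0 <= lambda)%R.
  by rewrite /lambda !mulr_ge0// invr_ge0 ltW.
pose beta := ((1 + alpha) / 2)%R.
have beta_ge : (alpha + M * expR (- (lambda * delta)) <= beta)%R.
  have lambda_delta : (lambda * delta = 2 * M / (1 - alpha))%R.
    by rewrite /lambda divfK// gt_eqF.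
  have : (2 * M <= (1 - alpha) * expR (lambda * delta))%R.
    rewrite -ler_pdivrMl// mulrC -lambda_delta.
    by rewrite (le_trans _ (expR_ge1Dx _))// lerDr.
  have := expR_gt0 (lambda * delta); rewrite expRN -lerBrDl /beta.
  set E := expR (lambda * delta) => E0 le_M.
  by rewrite ler_pdivrMr//; lra.
exists (fun s => expR (lambda * s)), beta; split.
- rewrite /beta divr_ge0 ?addr_ge0//= ltr_pdivrMr// mul1r.
  by rewrite -[2%R]/(1 + 1)%R ltrD2l.
- by apply: measurableT_comp => //; exact: measurable_funM.
- by move=> s; exact: expR_ge0.
- by move=> s s0; rewrite -expR0 ler_expR mulr_ge0// ltW.
apply: lebesgue_aeS2 kM kalpha => t kM_t kalpha_t tT.
rewrite -EFinM; apply: (@le_trans _ _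
   ((alpha + M * expR (- (lambda * delta))) * expR (lambda * t))%:E); last first.
  by rewrite lee_fin ler_wpM2r// expR_ge0.
apply: integral_expR_weight => //.
- exact: measurable_row (measurable_zero_ext_kernel mk).
- by move=> s; exact: zero_ext_kernel_ge0.
- by move=> s st; rewrite zero_ext_kernel_volterra// => -[].
- apply: le_trans (kM_t tT).
  rewrite (volterra_opE (q := zero_ext_kernel k) (phi := cst 1)).
  + by rewrite /kernel_op; under [leRHS]eq_integral do rewrite mule1.
  + exact: zero_ext_kernel_volterra.
  + by move=> s /andP[s0 st]; rewrite mule1 zero_ext_kernelE.
- exact: kalpha_t.
Qed.

End Contraction.

(** * The Gronwall inequality for kernels of the class *)

Theorem lemma2p2 (R : realType) (k : R * R -> R) (f g : R -> R)
  (k_class : kernel_class k)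
  (f_meas : measurable_fun (`[0%R, +oo[ : set R) f)
  (g_meas : measurable_fun (`[0%R, +oo[ : set R) g)
  (f_ge0 : forall t : R, (0 <= t)%R -> (0 <= f t)%R)
  (g_ge0 : forall t : R, (0 <= t)%R -> (0 <= g t)%R)
  (f_bounded : forall T : R, (0 < T)%R -> exists2 n : nat, (1 <= n)%N &
     in_Linfty T (fun t =>
       \int[lebesgue_measure]_(s in `[0%R, t])
         (iterated_kernel k n (t, s) * (f s)%:E)))
  (g_integrable : {ae lebesgue_measure, forall t : R, (0 < t)%R ->
     \int[lebesgue_measure]_(s in `[0%R, t])
       (resolvent k (t, s) * (g s)%:E) < +oo})
  (f_le : {ae lebesgue_measure, forall t : R, (0 < t)%R ->
     (f t)%:E <= (g t)%:E +
       \int[lebesgue_measure]_(s in `[0%R, t]) ((k (t, s))%:E * (f s)%:E)}) :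
  {ae lebesgue_measure, forall t : R, (0 < t)%R ->
     (f t)%:E <= (g t)%:E +
       \int[lebesgue_measure]_(s in `[0%R, t])
         (resolvent k (t, s) * (g s)%:E)}.
Proof.
pose mu := @lebesgue_measure R.
have [mk k0 _] := k_class.
pose kap := zero_ext_kernel k.
have kap0 : forall p, 0 <= kap p := zero_ext_kernel_ge0 k0.
have mkap : measurable_fun setT kap := measurable_zero_ext_kernel mk.
have kapV : forall p, ~ triangle p -> kap p = 0 := zero_ext_kernel_volterra k.
pose F := EFin \o zero_ext f; pose G := EFin \o zero_ext g.
have FE t : (0 <= t)%R -> F t = (f t)%:E.
  by move=> t0; rewrite /F/= zero_extE.
have GE t : (0 <= t)%R -> G t = (g t)%:E.
  by move=> t0; rewrite /G/= zero_extE.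
have F0 s : 0 <= F s by rewrite lee_fin zero_ext_ge0.
have G0 s : 0 <= G s by rewrite lee_fin zero_ext_ge0.
have mF : measurable_fun setT F.
  by apply/measurable_EFinP; exact: measurable_zero_ext.
have mG : measurable_fun setT G.
  by apply/measurable_EFinP; exact: measurable_zero_ext.
have kernelE n t : \int[mu]_(s in `[0%R, t])
    (iterated_kernel k n.+1 (t, s) * (f s)%:E) =
    iter n.+1 (kernel_op mu kap) F t.
  rewrite -kernel_op_iter//; apply: volterra_opE.
    exact: kernel_iter_volterra.
  by move=> s /andP[s0 st]; rewrite iterated_kernelE// /F/= zero_extE.
have resE t : \int[mu]_(s in `[0%R, t]) (resolvent k (t, s) * (g s)%:E) =
    \sum_(0 <= n <oo) iter n.+1 (kernel_op mu kap) G t.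
  under eq_eseriesr do rewrite -kernel_op_iter//.
  rewrite -(kernel_op_series mu t (fun n => kernel_iter_ge0 mu n kap0)
    (zero_ext_ge0 g_ge0) (fun n => measurable_kernel_iter mu n kap0 mkap)
    (measurable_zero_ext g_meas)).
  apply: volterra_opE => [p np|s /andP[s0 st]].
    by rewrite eseries0// => n _ _; exact: kernel_iter_volterra.
  by rewrite resolventE//= zero_extE.
have := @volterra_gronwall R kap kap0 mkap kapV F G F0 G0 mF mG.
have contr T (T0 : (0 < T)%R) := kernel_class_contraction k_class T0.
move=> /(_ contr) gronwall.
have F_bounded T : (0 < T)%R -> exists n, exists2 C : R, (0 <= C)%R &
    {ae mu, forall t : R, (0 < t < T)%R ->
      iter n (kernel_op mu kap) F t <= C%:E}.
  move=> T0; have [[//|n] _ /(in_Linfty_ae T0)[C C0 le_C]] := f_bounded T T0.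
  exists n.+1, C => //; apply: lebesgue_aeS le_C => t le_C tT.
  by rewrite -kernelE; exact: le_C.
have F_le : {ae mu, forall t : R, (0 < t)%R ->
    F t <= G t + kernel_op mu kap F t}.
  apply: lebesgue_aeS f_le => t le_t t0.
  have -> : kernel_op mu kap F t = _ := esym (kernelE 0%N t).
  by rewrite (FE t (ltW t0)) (GE t (ltW t0)); exact: le_t.
apply: lebesgue_aeS (gronwall F_bounded F_le) => t le_t t0.
by rewrite resE -(FE t (ltW t0)) -(GE t (ltW t0)); exact: le_t.
Qed.
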